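(* Let $f$ be defined for integers $n \ge 1$, $k \ge 2$ by \[ f(n,k) = \begin{cases} \sqrt{k/n} & \text{if } 2 \le k < 2 n^{1/3}, \\ \left( \dfrac{\log_2 (k/n^{1/3})}{n} \right)^{1/3} & \text{if } 2 n^{1/3} \le k < n^{1/3} 2^n, \\ 1 & \text{if } n^{1/3} 2^n \le k. \end{cases} \] There is a universal constant $C \ge 1$ such that, for all sufficiently large $n$ (that is, all $n \ge n_0$ with $n_0$ not depending on $k$) and all integers $k \ge 2$, \[ \frac{1}{C} \le \frac{\mathcal{R}_n(\mathcal{F}_k)}{f(n,k)} \le C , \] where $\mathcal{R}_n(\mathcal{F}_k)$ is the minimax total variation risk, based on $n$ i.i.d. samples, of the class $\mathcal{F}_k$ of non-increasing densities on $\{1,\dots,k\}$.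
   Context: A density on $\mathcal{X} = \{1,\dots,k\}$ is a probability mass function, i.e. a function $p : \{1,\dots,k\} \to [0,\infty)$ with $\sum_{x} p(x) = 1$. $\mathcal{F}_k$ is the class of densities $p$ on $\{1,\dots,k\}$ with $p(x+1) \le p(x)$ for all $x \in \{1,\dots,k-1\}$. For functions $g,h : \mathcal{X} \to \mathbb{R}$ put $\mathrm{TV}(g,h) = \frac12 \sum_{x \in \mathcal{X}} |g(x)-h(x)|$. A density estimate is a (possibly randomized) map $\hat f_n : \mathcal{X}^n \to \mathbb{R}^{\mathcal{X}}$. The risk of $\hat f_n$ with respect to a class $\mathcal{F}$ of densities on $\mathcal{X}$ is \[ \mathcal{R}_n(\hat f_n, \mathcal{F}) = \sup_{p \in \mathcal{F}} \mathbb{E}\bigl\{ \mathrm{TV}(\hat f_n(X_1,\dots,X_n), p) \bigr\}, \] where $X_1,\dots,X_n$ are i.i.d. with density $p$ and the expectation is over the samples and any randomization of the estimate. The minimax risk is $\mathcal{R}_n(\mathcal{F}) = \inf_{\hat f_n} \mathcal{R}_n(\hat f_n, \mathcal{F})$, the infimum over all density estimates. *)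

(* Defs.v *)
From HB Require Import structures.
From mathcomp Require Import all_boot all_order all_algebra.
From mathcomp Require Import all_classical all_reals all_analysis.

Set Implicit Arguments.
Unset Strict Implicit.
Unset Printing Implicit Defensive.

Import Order.TTheory GRing.Theory Num.Theory.

Local Open Scope classical_set_scope.
Local Open Scope ring_scope.

(* The alphabet {1, ..., k} is represented by 'I_k, so that the ordinal of
   value i stands for the letter i + 1. *)

Section minimax.
Variable R : realType.
Implicit Types n k : nat.

Definition is_density k (p : 'I_k -> R) : Prop :=
  (forall x, 0 <= p x) /\ \sum_(x < k) p x = 1.

Definition monotone_densities k : set ('I_k -> R) :=
  [set p | is_density p /\
           forall x y : 'I_k, y = x.+1 :> nat -> p y <= p x].

Definition TV k (g h : 'I_k -> R) : R := 2^-1 * \sum_(x < k) `|g x - h x|.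

(* A randomized estimate is a function of the sample and of a random seed drawn
   from a probability space of its own, independently of the sample.  No
   constraint is put on the values: they need not be densities. *)
Record estimate n k := Estimate {
  seed_display : measure_display ;
  seed : measurableType seed_display ;
  seed_law : probability seed R ;
  est : {ffun 'I_n -> 'I_k} -> seed -> ('I_k -> R) ;
  measurable_est : forall (xs : {ffun 'I_n -> 'I_k}) (x : 'I_k),
    measurable_fun [set: seed] (fun w => est xs w x)
}.

Arguments est {n k} e xs _ _.

(* An i.i.d. sample with density p equals xs with probability
   \prod_i p (xs i). *)
Definition expected_TV n k (fhat : estimate n k) (p : 'I_k -> R) : \bar R :=
  (\sum_(xs : {ffun 'I_n -> 'I_k})
     (\prod_(i < n) p (xs i))%:E *
     'E_(seed_law fhat)[fun w => TV (est fhat xs w) p])%E.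

Definition risk n k (fhat : estimate n k) (F : set ('I_k -> R)) : \bar R :=
  ereal_sup [set expected_TV fhat p | p in F].

Definition minimax_risk n k (F : set ('I_k -> R)) : \bar R :=
  ereal_inf [set r | exists fhat : estimate n k, r = risk fhat F].

Definition log2 (x : R) : R := ln x / ln 2.

Definition rate n k : R :=
  let cbrt (x : R) := x `^ (3^-1) in
  if k%:R < 2 * cbrt n%:R then Num.sqrt (k%:R / n%:R)
  else if k%:R < cbrt n%:R * 2 ^+ n then
    cbrt (log2 (k%:R / cbrt n%:R) / n%:R)
  else 1.

End minimax.

Arguments monotone_densities R k : clear implicits.
Arguments minimax_risk {R} n {k} F.
Arguments rate R n k : clear implicits.

(* Main.v *)
Require Import Defs.
From mathcomp Require Import all_boot all_order all_algebra.
From mathcomp Require Import all_classical all_reals all_analysis.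
From mathcomp Require Import measurable_realfun.
From mathcomp Require Import ring lra zify.

Set Implicit Arguments.
Unset Strict Implicit.
Unset Printing Implicit Defensive.

Import Order.TTheory GRing.Theory Num.Theory.
Local Open Scope ring_scope.

(** The lower and the upper bound are proved separately, each by a
    construction whose free parameters are adapted to the range of [k].

    Upper bound.  Cut the alphabet into consecutive bins, estimate the mass of
    every bin by its empirical frequency and spread that mass uniformly over
    the bin.  If a bin that contains the letter [a] extends beyond [a] by at
    most [d * a] letters, then replacing a monotone density by its bin
    averages costs at most [2 * d] in L1 distance, whatever the density is
    ([bin_average_bias]); and with [m] bins the empirical frequencies are off
    by [sqrt (m / n)] in L1 distance ([bin_frequency_deviation]).  Singleton
    bins ([d = 0], [m = k]) give [sqrt (k / n)].  About [n^(1/3)]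
    singletons followed by bins whose length is proportional to their position,
    with ratio [d = (L / n)^(1/3)] where [L = log2 (k / n^(1/3))], number at
    most a constant times [L / d], so that both errors are of the order of
    [d].  For still larger alphabets the zero
    estimate has risk [1/2].

    Lower bound.  Every estimate, randomized or not, does at least as badly in
    the worst case as on average over a hypercube of densities, and there
    Assouad's lemma ([minimax_risk_ge_assouad]) applies: if flipping one
    coordinate changes the density by [s] in L1 distance but so little in
    chi-square distance that [n] samples do not reveal it, then each of the [r]
    coordinates contributes a constant times [s].  The hypercube consists of
    perturbed staircases.  The widths of the steps double [S - 1] times and
    each width is used for [N] consecutive steps, along which the height drops
    linearly by a factor of two; thus all steps have comparable mass, and the
    drop between consecutive steps leaves room to tilt each of them by a
    relative amount [theta / N] without destroying monotonicity.  The
    staircase needs about [2 * N * 2 ^ S] letters, a tilt is invisible as soon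
    as [16 * n * theta ^ 2 <= N ^ 3 * S], and the resulting bound is
    [theta / (8 * N)] ([minimax_risk_ge_dyadic]).  Taking [S = 1] and
    [N] about [k / 2] gives [sqrt (k / n)]; taking [S] proportional to [L] and
    [N] about [(n / S)^(1/3)] gives [(L / n)^(1/3)]; taking [S = n] and [N = 1]
    gives a constant. *)

(** * Minimax risk and deterministic estimates *)

Section risk_bounds.
Variable R : realType.
Implicit Types n k : nat.

Lemma TV_ge0 k (g h : 'I_k -> R) : 0 <= TV g h.
Proof. by rewrite mulr_ge0 ?invr_ge0 ?ler0n// sumr_ge0. Qed.

(** The worst case is at least the average over a finite family, and averaging
    commutes with the expectation over the seed; so it is enough to bound the
    average risk from below for each fixed value of the seed, that is, for
    every deterministic estimate. *)
Lemma minimax_risk_ge n k (F : set ('I_k -> R)) (T : finType)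
    (p : T -> 'I_k -> R) (c : R) :
  (0 < #|T|)%N -> (forall t x, 0 <= p t x) -> (forall t, F (p t)) ->
  (forall e : {ffun 'I_n -> 'I_k} -> 'I_k -> R,
     c * #|T|%:R <=
     \sum_t \sum_(xs : {ffun 'I_n -> 'I_k}) (\prod_i p t (xs i)) * TV (e xs) (p t)) ->
  (c%:E <= minimax_risk n F)%E.
Proof.
move=> T0 p0 Fp ce; apply: le_ereal_inf_tmp => _ [fhat ->].
case: fhat => d seed P est mest; set fhat := Estimate _ _.
have mTV xs (t : T) : measurable_fun setT (fun w => (TV (est xs w) (p t))%:E).
  apply/measurable_EFinP; apply: measurable_funM => //.
  apply: (@measurable_sum _ _ _ _ _ _ (fun x w => `|est xs w x - p t x|)) => x.
  apply: measurableT_comp => //.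
  by apply: measurable_funB => //; exact: mest.
have prod0 (t : T) (xs : {ffun 'I_n -> 'I_k}) : 0 <= \prod_i p t (xs i).
  by apply: prodr_ge0.
have TV0 xs (t : T) (w : seed) : (0 <= (TV (est xs w) (p t))%:E)%E.
  by rewrite lee_fin; exact: TV_ge0.
have sumE : (\sum_t expected_TV fhat (p t) = \int[P]_w (\sum_t \sum_(xs : {ffun 'I_n -> 'I_k})
    (\prod_i p t (xs i)) * TV (est xs w) (p t))%:E)%E.
  under eq_integral do rewrite -sumEFin.
  rewrite ge0_integral_sum//; first last.
  - move=> t w _; rewrite -sumEFin; apply: sume_ge0 => xs _.
    by rewrite EFinM mule_ge0// lee_fin.
  - move=> t; under eq_fun do rewrite -sumEFin.
    apply: emeasurable_sum => xs; under eq_fun do rewrite EFinM.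
    exact: measurable_funeM.
  apply: eq_bigr => t _; rewrite /expected_TV.
  under [RHS]eq_integral do rewrite -sumEFin.
  rewrite ge0_integral_sum//; first last.
  - by move=> xs w _; rewrite EFinM mule_ge0// lee_fin.
  - move=> xs; under eq_fun do rewrite EFinM.
    exact: measurable_funeM.
  apply: eq_bigr => xs _; rewrite expectation.unlock /=.
  under [RHS]eq_integral do rewrite EFinM.
  by rewrite ge0_integralZl_EFin// => w _; exact: TV0.
have sum_ge : ((c * #|T|%:R)%:E <= \sum_t expected_TV fhat (p t))%E.
  have -> : (c * #|T|%:R)%:E = (\int[P]_w (c * #|T|%:R)%:E)%E.
    by rewrite integral_cst// [X in (_ * X)%E]probability_setT mule1.
  rewrite sumE; case: (leP 0 (c * #|T|%:R)) => c0; last first.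
    apply: (@le_trans _ _ 0%E).
      by rewrite integral_cst// [X in (_ * X)%E]probability_setT mule1 lee_fin ltW.
    apply: integral_ge0 => w _; rewrite lee_fin; apply: sumr_ge0 => t _.
    by apply: sumr_ge0 => xs _; rewrite mulr_ge0// TV_ge0.
  apply: ge0_le_integral => //.
  - under eq_fun do rewrite -sumEFin; apply: emeasurable_sum => t.
    under eq_fun do rewrite -sumEFin; apply: emeasurable_sum => xs.
    under eq_fun do rewrite EFinM.
    exact: measurable_funeM.
  - by move=> w _; rewrite lee_fin; exact: ce.
have le_risk t : (expected_TV fhat (p t) <= risk fhat F)%E.
  by apply: ereal_sup_ubound; exists (p t).
have sum_le : (\sum_t expected_TV fhat (p t) <= \sum_(t : T) risk fhat F)%E.
  by apply: lee_sum => t _.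
have risk_ge0 : (0 <= risk fhat F)%E.
  case/card_gt0P: T0 => t _; apply: le_trans (le_risk t).
  apply: sume_ge0 => xs _; rewrite mule_ge0 ?lee_fin// expectation.unlock.
  exact: integral_ge0.
move: risk_ge0 (le_trans sum_ge sum_le); case: (risk fhat F) => [r _| |//].
- by rewrite sumEFin sumr_const lee_fin -[leRHS]mulr_natr ler_pM2r ?ltr0n// lee_fin.
- by move=> _ _; exact: leey.
Qed.

(** A deterministic estimate is a randomized one whose seed lives on a one-point
    space. *)
Lemma minimax_risk_le n k (F : set ('I_k -> R))
    (e : {ffun 'I_n -> 'I_k} -> 'I_k -> R) (c : R) :
  (forall p, F p -> \sum_(xs : {ffun 'I_n -> 'I_k}) (\prod_i p (xs i)) * TV (e xs) p <= c) ->
  (minimax_risk n F <= c%:E)%E.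
Proof.
move=> ec.
have me (xs : {ffun 'I_n -> 'I_k}) (x : 'I_k) :
  measurable_fun [set: unit] (fun=> e xs x) by [].
pose fhat := Estimate (dirac tt : probability unit R) me.
apply: ge_ereal_inf; exists (risk fhat F); first by exists fhat.
apply: ge_ereal_sup => _ [p Fp <-].
apply: le_trans (_ : (\sum_(xs : {ffun 'I_n -> 'I_k}) (\prod_i p (xs i)) * TV (e xs) p)%:E <= _)%E.
  rewrite /expected_TV -sumEFin lee_sum// => xs _.
  by rewrite expectation.unlock /= integral_cst// [X in (_ * (_ * X))%E]probability_setT mule1.
by rewrite lee_fin ec.
Qed.

End risk_bounds.

(** * Sums over independent samples *)

Section sample_sums.
Variable R : realType.
Implicit Types n k : nat.

Lemma sum_sample_prod n k (f : 'I_n -> 'I_k -> R) :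
  \sum_(xs : {ffun 'I_n -> 'I_k}) \prod_i f i (xs i) = \prod_i \sum_x f i x.
Proof. by rewrite bigA_distr_bigA. Qed.

(** Independence: once the square is expanded, a cross term contains the factor
    [\sum_x p x * g x], and only the diagonal survives. *)
Lemma second_moment_sample_sum n k (p g : 'I_k -> R) :
  is_density p -> \sum_x p x * g x = 0 ->
  \sum_(xs : {ffun 'I_n -> 'I_k})
     (\prod_i p (xs i)) * (\sum_i g (xs i)) ^+ 2 =
  n%:R * \sum_x p x * g x ^+ 2.
Proof.
move=> [p0 p1] pg0.
(* [\prod_i f j l i (xs i)] is the probability of [xs] times the cross term
   [g (xs j) * g (xs l)]. *)
pose f (j l i : 'I_n) x := p x * (if i == j then g x else 1) *
                           (if i == l then g x else 1).
have fE (xs : {ffun 'I_n -> 'I_k}) : (\prod_i p (xs i)) * (\sum_i g (xs i)) ^+ 2 =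
    \sum_j \sum_l \prod_i f j l i (xs i).
  rewrite expr2 big_distrlr mulr_sumr; apply: eq_bigr => j _.
  rewrite mulr_sumr; apply: eq_bigr => l _.
  rewrite /f !big_split/= -!big_mkcond/= !big_pred1_eq.
  by rewrite mulrA.
under eq_bigr do rewrite fE.
rewrite exchange_big /=.
have -> : n%:R * \sum_x p x * g x ^+ 2 = \sum_(j < n) \sum_x p x * g x ^+ 2.
  by rewrite sumr_const card_ord mulr_natl.
apply: eq_bigr => j _; rewrite exchange_big /= (bigD1 j)//= [X in _ + X]big1.
  rewrite addr0 sum_sample_prod (bigD1 j)//= [X in _ * X]big1 => [|i /negPf ij].
    rewrite mulr1; apply: eq_bigr => x _.
    by rewrite /f eqxx expr2 mulrA.
  by rewrite -[RHS]p1; apply: eq_bigr => x _; rewrite /f ij !mulr1.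
move=> l /negPf lj; rewrite sum_sample_prod (bigD1 j)//=.
rewrite [X in X * _](_ : _ = 0) ?mul0r//.
by rewrite -[RHS]pg0; apply: eq_bigr => x _; rewrite /f eqxx eq_sym lj mulr1.
Qed.

End sample_sums.

(** * Monotone densities and their bin averages *)

Section bias.
Variable R : realType.
Implicit Types k : nat.

(** Summation by parts.  For a density [P] on [m] letters this says that the
    total of the drops [P z - P z.+1], each weighted by the position at which
    it occurs, is the total mass. *)
Lemma sum_mul_decrement (P : nat -> R) m :
  \sum_(z < m) (P z - P z.+1) * z.+1%:R = \sum_(z < m) P z - m%:R * P m.
Proof.
elim: m => [|m IH]; first by rewrite !big_ord0 mul0r subrr.
by rewrite !big_ord_recr/= IH -(natr1 m); ring.
Qed.

Lemma telescope_ord (P : nat -> R) m x y : (x <= y <= m)%N ->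
  P x - P y = \sum_(z < m) (x <= z < y)%N%:R * (P z - P z.+1).
Proof.
elim: m y => [|m IH] y /andP[xy ym].
  by rewrite big_ord0 (_ : x = y) ?subrr//; lia.
rewrite big_ord_recr/=; case: (ltnP y m.+1) => [ym'|my].
  by rewrite -IH ?xy// andbF mul0r addr0.
have yE : y = m.+1 by lia.
move: xy; rewrite {ym my}yE => xy.
case: (ltnP m x) => [mx|xm].
  have -> : x = m.+1 by lia.
  rewrite mul0r addr0 subrr big1// => z _.
  by rewrite leqNgt ltnS ltnW ?mul0r.
rewrite mul1r (_ : P x - _ = P x - P m + (P m - P m.+1)); last by ring.
congr (_ + _); rewrite IH ?xm ?leqnn//; apply: eq_bigr => z _.
by rewrite ltn_ord (ltn_trans (ltn_ord z)) ?ltnSn.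
Qed.

Variables (k : nat) (J : finType) (b : 'I_k -> J).

Definition bin_size x : R := #|[pred y | b y == b x]|%:R.

Lemma bin_size_gt0 x : 0 < bin_size x.
Proof. by rewrite ltr0n; apply/card_gt0P; exists x; rewrite inE. Qed.

(** Each nonempty bin contributes its value once; the inequality is strict only
    when some positive [F j] belongs to an empty bin. *)
Lemma sum_over_bins (F : J -> R) : (forall j, 0 <= F j) ->
  \sum_x F (b x) / bin_size x <= \sum_j F j.
Proof.
move=> F0; rewrite (partition_big b predT)//=; apply: ler_sum => j _.
under eq_bigr => x /eqP bx.
  rewrite /bin_size bx; over.
rewrite sumr_const -[leLHS]mulr_natr -mulrA -[leRHS]mulr1 ler_wpM2l//.
case: (posnP #|[pred y | b y == j]|) => [->|c0]; first by rewrite mulr0.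
by rewrite mulVf// pnatr_eq0 -lt0n.
Qed.

Definition bin_average (p : 'I_k -> R) x : R :=
  (\sum_(y | b y == b x) p y) / bin_size x.

Variable d : R.
Hypothesis d0 : 0 <= d.
Hypothesis b_convex : forall x z y : 'I_k,
  (x <= z <= y)%N -> b x = b y -> b z = b y.
Hypothesis b_narrow : forall x y : 'I_k,
  (x <= y)%N -> b x = b y -> (y - x)%N%:R <= d * x.+1%:R.

Lemma card_bin_above (z : 'I_k) :
  #|[pred y : 'I_k | (b y == b z) && (z < y)%N]|%:R <= d * z.+1%:R.
Proof.
case: (pickP [pred y : 'I_k | (b y == b z) && (z < y)%N]) => [y0 y0P|no]; last first.
  by rewrite (eq_card0 no) mulr_ge0.
case: (arg_maxnP (fun y : 'I_k => y : nat) y0P) => y /andP[/eqP byz zy] ymax.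
apply: le_trans (b_narrow (ltnW zy) (esym byz)); rewrite ler_nat.
rewrite cardE -(size_map val) -(size_iota z.+1 (y - z)).
apply: uniq_leq_size; first by rewrite map_inj_uniq ?enum_uniq//; exact: val_inj.
move=> _ /mapP[w + ->]; rewrite mem_enum => wP.
have := ymax _ wP; move: wP => /andP[_ zw] wy; rewrite mem_iota /=.
by move: zw wy zy => /=; lia.
Qed.

(** The weight with which the drop of the density between the letters [z] and
    [z.+1] enters the L1 distance to the bin averages: the pairs of letters of
    one bin that are separated by this drop, divided by the size of the bin.
    Such a pair must lie in the bin of [z], and for each left member there are
    at most [d * z.+1] right members. *)
Lemma bin_straddle_weight (z : 'I_k) :
  \sum_x \sum_(y | b y == b x) (x <= z < y)%N%:R / bin_size x <= d * z.+1%:R.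
Proof.
apply: le_trans (_ : \sum_(x | b x == b z) d * z.+1%:R / bin_size z <= _).
  rewrite [leRHS]big_mkcond; apply: ler_sum => x _.
  case: ifPn => [/eqP bxz|bxz].
    rewrite -mulr_suml /bin_size bxz ler_wpM2r ?invr_ge0//.
    apply: le_trans (card_bin_above z); rewrite -sum1_card natr_sum.
    rewrite [leRHS]big_mkcond [leLHS]big_mkcond; apply: ler_sum => y _ /=.
    rewrite !inE; case: eqP => //= _.
    by case: ifP => _; rewrite ?andbF ?andbT// ler_nat leq_b1.
  rewrite big1// => y /eqP byx.
  case: (boolP (x <= z < y)%N) => [/andP[xz zy]|]; last by rewrite mul0r.
  (* A drop strictly inside a bin is a drop at a letter of this bin. *)
  have := @b_convex x z y; rewrite xz ltnW// byx => /(_ isT erefl) bz.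
  by rewrite bz eqxx in bxz.
rewrite sumr_const -[leLHS]mulr_natr -mulrA mulVf ?mulr1//.
exact: lt0r_neq0 (bin_size_gt0 z).
Qed.

(** Within a bin, the distance of [p x] to the average is at most the average of
    [`|p x - p y|], and such a difference is the sum of the drops between [x]
    and [y].  By [bin_straddle_weight] the drop after [z] is counted at most
    [2 * d * z.+1] times in total, and [sum_mul_decrement] evaluates the sum. *)
Lemma bin_average_bias (p : 'I_k -> R) : monotone_densities R k p ->
  \sum_x `|bin_average p x - p x| <= 2 * d.
Proof.
move=> [[p0 p1] pdec].
(* Extending [p] by zero makes the drop after the last letter equal to its
   mass, as the summation by parts requires. *)
pose P z := if insub z is Some x then p x else 0.
have PE (x : 'I_k) : P x = p x by rewrite /P valK.
have Pk : P k = 0 by rewrite /P insubF// ltnn.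
have D0 (z : 'I_k) : 0 <= P z - P z.+1.
  rewrite PE /P; case: insubP => [y _ yz|_]; last by rewrite subr0.
  by rewrite subr_ge0 pdec.
have absE (x y : 'I_k) : `|p x - p y| =
    \sum_(z < k) ((x <= z < y)%N%:R + (y <= z < x)%N%:R) * (P z - P z.+1).
  wlog xy : x y / (x <= y)%N => [H|].
    case/orP: (leq_total x y) => ?; first exact: H.
    by rewrite distrC H//; apply: eq_bigr => z _; rewrite addrC.
  have <- : P x - P y = `|p x - p y|.
    by rewrite (@telescope_ord P k) ?xy 1?ltnW// -!PE ger0_norm// (@telescope_ord P k) ?xy 1?ltnW//;
     apply: sumr_ge0 => z _; rewrite mulr_ge0.
  rewrite (@telescope_ord P k) ?xy 1?ltnW//; apply: eq_bigr => z _.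
  rewrite [X in _ + X%:R](_ : _ = 0%N) ?addr0//.
  by case: andP => // -[]; lia.
apply: le_trans (_ : \sum_x \sum_(y | b y == b x) `|p x - p y| / bin_size x <= _).
  apply: ler_sum => x _.
  have -> : bin_average p x - p x = (\sum_(y | b y == b x) (p y - p x)) / bin_size x.
    rewrite sumrB mulrBl; congr (_ - _).
    rewrite sumr_const -[X in _ = X / _]mulr_natr mulfK//; exact: lt0r_neq0 (bin_size_gt0 x).
  rewrite normrM normfV (gtr0_norm (bin_size_gt0 x)) -mulr_suml.
  rewrite ler_pM2r ?invr_gt0; last exact: bin_size_gt0.
  apply: le_trans (ler_norm_sum _ _ _) _; apply: ler_sum => y _.
  by rewrite distrC.
under eq_bigr => x _ do under eq_bigr => y _ do rewrite absE mulr_suml.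
under eq_bigr => x _ do rewrite exchange_big/=.
rewrite exchange_big/=.
have <- : \sum_(z < k) (2 * (d * z.+1%:R)) * (P z - P z.+1) = 2 * d.
  transitivity (2 * d * \sum_(z < k) (P z - P z.+1) * z.+1%:R).
    by rewrite mulr_sumr; apply: eq_bigr => z _; ring.
  rewrite sum_mul_decrement Pk mulr0 subr0.
  by under eq_bigr do rewrite PE; rewrite p1 mulr1.
apply: ler_sum => z _.
rewrite [leLHS](_ : _ =
   (\sum_x \sum_(y | b y == b x) (x <= z < y)%N%:R / bin_size x +
    \sum_x \sum_(y | b y == b x) (y <= z < x)%N%:R / bin_size x)
   * (P z - P z.+1)); last first.
  rewrite -big_split/= mulr_suml; apply: eq_bigr => x _.
  by rewrite -big_split/= mulr_suml; apply: eq_bigr => y _; ring.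
rewrite ler_wpM2r// [leRHS]mulr_natl mulr2n lerD ?bin_straddle_weight//.
apply: le_trans (bin_straddle_weight z).
rewrite (exchange_big_dep predT)//= le_eqVlt; apply/orP; left; apply/eqP.
apply: eq_bigr => x _; apply: eq_big => [y|y /eqP bxy]; first exact: eq_sym.
by rewrite /bin_size bxy.
Qed.

End bias.

(** * Histogram estimates *)

Section histogram.
Variables (R : realType) (n k : nat) (J : finType) (b : 'I_k -> J).
Hypothesis n0 : (0 < n)%N.

Definition bin_frequency (xs : {ffun 'I_n -> 'I_k}) (j : J) : R :=
  (\sum_i (b (xs i) == j)%:R) / n%:R.

Definition histogram (xs : {ffun 'I_n -> 'I_k}) (x : 'I_k) : R :=
  bin_frequency xs (b x) / bin_size R b x.

Definition bin_mass (p : 'I_k -> R) (j : J) : R := \sum_(y | b y == j) p y.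

Lemma sum_sample_density (p : 'I_k -> R) : is_density p ->
  \sum_(xs : {ffun 'I_n -> 'I_k}) \prod_i p (xs i) = 1.
Proof.
move=> [_ p1]; rewrite (sum_sample_prod (fun _ => p)).
by rewrite big1.
Qed.

Lemma bin_frequency_variance (p : 'I_k -> R) j : is_density p ->
  \sum_(xs : {ffun 'I_n -> 'I_k})
    (\prod_i p (xs i)) * (bin_frequency xs j - bin_mass p j) ^+ 2
  <= bin_mass p j / n%:R.
Proof.
move=> dp; have [p0 p1] := dp.
have n0R : n%:R != 0 :> R by rewrite pnatr_eq0 -lt0n.
pose g x : R := (b x == j)%:R - bin_mass p j.
have massE : \sum_x p x * (b x == j)%:R = bin_mass p j.
  rewrite /bin_mass [RHS]big_mkcond; apply: eq_bigr => x _.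
  by case: ifP => _; rewrite ?mulr1 ?mulr0.
have g_centered : \sum_x p x * g x = 0.
  under eq_bigr do rewrite mulrBr.
  by rewrite sumrB massE -mulr_suml p1 mul1r subrr.
have -> : \sum_(xs : {ffun 'I_n -> 'I_k})
    (\prod_i p (xs i)) * (bin_frequency xs j - bin_mass p j) ^+ 2 =
  n%:R ^- 2 * \sum_(xs : {ffun 'I_n -> 'I_k})
     (\prod_i p (xs i)) * (\sum_i g (xs i)) ^+ 2.
  rewrite mulr_sumr; apply: eq_bigr => xs _.
  rewrite [RHS]mulrCA; congr (_ * _).
  rewrite -exprVn -exprMn; congr (_ ^+ 2).
  rewrite sumrB sumr_const card_ord mulrC mulrBl; congr (_ - _).
  by rewrite -[X in X / _]mulr_natr mulfK.
rewrite second_moment_sample_sum//.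
have -> : n%:R ^- 2 * (n%:R * \sum_x p x * g x ^+ 2) =
    (\sum_x p x * g x ^+ 2) / n%:R by field.
rewrite ler_wpM2r ?invr_ge0// -massE.
have -> : \sum_x p x * g x ^+ 2 =
    \sum_x p x * (b x == j)%:R - bin_mass p j ^+ 2.
  transitivity (\sum_x (p x * (b x == j)%:R - (bin_mass p j * 2) * (p x * (b x == j)%:R)
      + p x * bin_mass p j ^+ 2)).
    apply: eq_bigr => x _; rewrite /g; case: eqP => _ /=; ring.
  rewrite big_split/= sumrB -mulr_sumr -mulr_suml p1 massE; ring.
by rewrite lerBlDr lerDl sqr_ge0.
Qed.

(** The inequality [`|y| <= t / 2 * y ^+ 2 + (2 * t)^-1] turns the variance bound
    into a bound for the first moment; the free parameter [t] replaces square
    roots and will be chosen to balance the two terms. *)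
Lemma bin_frequency_deviation (p : 'I_k -> R) (t : R) : 0 < t -> is_density p ->
  \sum_(xs : {ffun 'I_n -> 'I_k})
    (\prod_i p (xs i)) * (\sum_j `|bin_frequency xs j - bin_mass p j|)
  <= t / (2 * n%:R) + #|J|%:R / (2 * t).
Proof.
move=> t0 dp; have [p0 p1] := dp.
have n0R : n%:R != 0 :> R by rewrite pnatr_eq0 -lt0n.
have prod0 (xs : {ffun 'I_n -> 'I_k}) : 0 <= \prod_i p (xs i) by exact: prodr_ge0.
have abs_le (y : R) : `|y| <= t / 2 * y ^+ 2 + (2 * t)^-1.
  rewrite -[y ^+ 2]real_normK ?num_real// -subr_ge0.
  have -> : t / 2 * `|y| ^+ 2 + (2 * t)^-1 - `|y| = (2 * t)^-1 * (t * `|y| - 1) ^+ 2.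
    by field; exact: lt0r_neq0.
  by rewrite mulr_ge0 ?sqr_ge0// invr_ge0 mulr_ge0// ltW.
under eq_bigr do rewrite mulr_sumr.
rewrite exchange_big/=.
apply: le_trans (_ : \sum_j (t / 2 * (bin_mass p j / n%:R) + (2 * t)^-1) <= _).
  apply: ler_sum => j _.
  apply: le_trans (_ : \sum_(xs : {ffun 'I_n -> 'I_k}) (t / 2 * ((\prod_i p (xs i)) *
     (bin_frequency xs j - bin_mass p j) ^+ 2) + (\prod_i p (xs i)) / (2 * t)) <= _).
    apply: ler_sum => xs _; apply: le_trans (ler_wpM2l (prod0 xs) (abs_le _)) _.
    by rewrite mulrDr mulrCA.
  rewrite big_split/= -mulr_sumr -mulr_suml (sum_sample_density dp) mul1r lerD2r.
  by rewrite ler_pM2l ?divr_gt0//; exact: bin_frequency_variance.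
rewrite big_split/= sumr_const -mulr_sumr -mulr_suml.
have -> : \sum_j bin_mass p j = 1.
  by rewrite -p1 [RHS](partition_big b predT).
by rewrite le_eqVlt; apply/orP; left; apply/eqP; rewrite -[X in _ + X]mulr_natl;
  field; rewrite n0R lt0r_neq0.
Qed.

Variable d : R.
Hypothesis d0 : 0 <= d.
Hypothesis b_convex : forall x z y : 'I_k,
  (x <= z <= y)%N -> b x = b y -> b z = b y.
Hypothesis b_narrow : forall x y : 'I_k,
  (x <= y)%N -> b x = b y -> (y - x)%N%:R <= d * x.+1%:R.

(** The triangle inequality through the bin averages: estimation error plus
    bias. *)
Lemma minimax_risk_le_histogram (t : R) : 0 < t ->
  (minimax_risk n (monotone_densities R k) <=
     (d + t / (4 * n%:R) + #|J|%:R / (4 * t))%:E)%E.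
Proof.
move=> t0; apply: (@minimax_risk_le _ _ _ _ histogram) => p pmono.
have [dp _] := pmono; have [p0 p1] := dp.
apply: le_trans (_ : \sum_(xs : {ffun 'I_n -> 'I_k}) (\prod_i p (xs i)) *
   (2^-1 * (\sum_j `|bin_frequency xs j - bin_mass p j|) + d) <= _).
  apply: ler_sum => xs _; rewrite ler_wpM2l ?prodr_ge0// /TV.
  rewrite -[leRHS](_ : 2^-1 * (\sum_j `|bin_frequency xs j - bin_mass p j| + 2 * d) = _);
    last by field.
  rewrite ler_wpM2l ?invr_ge0//.
  apply: le_trans (_ : \sum_x (`|bin_frequency xs (b x) - bin_mass p (b x)| / bin_size R b x
      + `|bin_average b p x - p x|) <= _).
    apply: ler_sum => x _.
    rewrite -[X in _ / X]gtr0_norm ?bin_size_gt0// -normfV -normrM.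
    apply: le_trans (ler_normD _ _); rewrite le_eqVlt; apply/orP; left; apply/eqP.
    by congr `|_|; rewrite /histogram /bin_average /bin_mass mulrBl addrA subrK.
  rewrite big_split/= lerD//; last exact: bin_average_bias.
  exact: (@sum_over_bins _ _ _ b (fun j => `|bin_frequency xs j - bin_mass p j|)).
under eq_bigr do rewrite mulrDr mulrCA.
rewrite big_split/= -mulr_sumr -mulr_suml (sum_sample_density dp) mul1r.
have := bin_frequency_deviation t0 dp.
set D := \sum_xs _ => Dle.
apply: le_trans (_ : 2^-1 * (t / (2 * n%:R) + #|J|%:R / (2 * t)) + d <= _).
  by rewrite lerD2r ler_wpM2l// invr_ge0.
rewrite le_eqVlt; apply/orP; left; apply/eqP; field.
by rewrite pnatr_eq0 -lt0n n0 lt0r_neq0.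
Qed.

End histogram.

Lemma minimax_risk_le_half (R : realType) n k :
  (minimax_risk n (monotone_densities R k) <= (2^-1)%:E)%E.
Proof.
apply: (@minimax_risk_le _ _ _ _ (fun _ _ => 0)) => p [[p0 p1] _].
rewrite -mulr_suml (sum_sample_density _ (conj p0 p1)) mul1r /TV.
by under eq_bigr do rewrite sub0r normrN ger0_norm//; rewrite p1 mulr1.
Qed.

(** * Assouad's lemma *)

Section assouad.
Variable R : realType.
Implicit Types n k r : nat.

(** With the ratio [r = c / a] this is [r - r ^+ 2 / 4 <= Num.min 1 r]; for
    [r >= 1] it says that [(1 - r / 2) ^+ 2 >= 0].  It is a polynomial
    substitute for the usual passage through the total variation or Hellinger
    distance. *)
Lemma min_ge_chi2 (a c : R) : 0 <= a -> 0 <= c -> (a = 0 -> c = 0) ->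
  c - c ^+ 2 / a / 4 <= Num.min a c.
Proof.
move=> a0 c0 ac; have [a_eq0|a_neq0] := eqVneq a 0.
  by rewrite ac// a_eq0 minxx; rewrite expr0n /= !mul0r subr0.
have a_gt0 : 0 < a by rewrite lt_neqAle eq_sym a_neq0.
rewrite le_min; apply/andP; split.
  rewrite -subr_ge0 (_ : _ - _ = (2 * a - c) ^+ 2 / a / 4); last by field.
  by rewrite divr_ge0// divr_ge0// sqr_ge0.
by rewrite lerBlDr lerDl divr_ge0// divr_ge0// sqr_ge0.
Qed.

(** The sum [\sum_x q x ^+ 2 / p x], which is one plus the chi-square divergence,
    is multiplicative over independent samples; together with [min_ge_chi2]
    this yields an overlap of at least [1 - 2 / 4]. *)
Lemma sample_affinity n k (p q : 'I_k -> R) : is_density p -> is_density q ->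
  (forall x, p x = 0 -> q x = 0) -> (\sum_x q x ^+ 2 / p x) ^+ n <= 2 ->
  2^-1 <= \sum_(xs : {ffun 'I_n -> 'I_k})
             Num.min (\prod_i p (xs i)) (\prod_i q (xs i)).
Proof.
move=> dp dq abs_cont chi2.
have [p0 _] := dp; have [q0 _] := dq.
apply: le_trans (_ : \sum_(xs : {ffun 'I_n -> 'I_k}) (\prod_i q (xs i) -
   (\prod_i q (xs i)) ^+ 2 / (\prod_i p (xs i)) / 4) <= _); last first.
  apply: ler_sum => xs _; apply: min_ge_chi2; rewrite ?prodr_ge0//.
  move=> /eqP; rewrite prodf_seq_eq0 => /hasP[i _ /= /eqP/abs_cont qi0].
  by apply/eqP; rewrite prodf_seq_eq0; apply/hasP; exists i; rewrite ?mem_index_enum// qi0 eqxx.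
rewrite sumrB (sum_sample_density _ dq) -mulr_suml.
have -> : \sum_(xs : {ffun 'I_n -> 'I_k}) (\prod_i q (xs i)) ^+ 2 / (\prod_i p (xs i))
    = (\sum_x q x ^+ 2 / p x) ^+ n.
  transitivity (\sum_(xs : {ffun 'I_n -> 'I_k}) \prod_i (q (xs i) ^+ 2 / p (xs i))).
    by apply: eq_bigr => xs _; rewrite big_split/= prodfV prodrXl.
  rewrite (sum_sample_prod (fun _ x => q x ^+ 2 / p x)).
  by rewrite prodr_const card_ord.
by lra.
Qed.

Definition flip r (tau : {ffun 'I_r -> bool}) (i : 'I_r) : {ffun 'I_r -> bool} :=
  [ffun j => (j == i) (+) tau j].

Lemma flipK r (i : 'I_r) : involutive (fun tau => flip tau i).
Proof. by move=> tau; apply/ffunP => j; rewrite !ffunE addbA addbb. Qed.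

(** Assouad's lemma.  Pair each vertex [tau] of the hypercube with its [i]-th
    neighbour.  Whatever is estimated from the sample [xs], the losses on the
    [i]-th block under the two vertices add up to at least [s], and both
    vertices give [xs] at least the minimum of its two probabilities; summed
    over [xs], these minima are at least [1/2]. *)
Lemma minimax_risk_ge_assouad n k r (F : set ('I_k -> R))
    (p : {ffun 'I_r -> bool} -> 'I_k -> R) (blk : 'I_k -> nat) (s : R) :
  (forall tau, is_density (p tau)) -> (forall tau, F (p tau)) ->
  (forall tau i x, p tau x = 0 -> p (flip tau i) x = 0) ->
  (forall tau i, (\sum_x p (flip tau i) x ^+ 2 / p tau x) ^+ n <= 2) ->
  0 <= s ->
  (forall tau (i : 'I_r), s <= \sum_(x | blk x == i) `|p tau x - p (flip tau i) x|) ->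
  ((r%:R * s / 8)%:E <= minimax_risk n F)%E.
Proof.
move=> dp Fp abs_cont chi2 s0 sep.
apply: (minimax_risk_ge (p := p)) => //; first by apply/card_gt0P; exists [ffun=> false].
  by move=> tau x; have [] := dp tau.
move=> e.
pose Q tau (xs : {ffun 'I_n -> 'I_k}) := \prod_i p tau (xs i).
pose loss (i : 'I_r) tau xs := \sum_(x | blk x == i) `|e xs x - p tau x|.
have Q0 tau xs : 0 <= Q tau xs.
  by apply: prodr_ge0 => i _; have [+ _] := dp tau; apply.
have block_risk (i : 'I_r) :
    #|{ffun 'I_r -> bool}|%:R * s / 4 <=
    \sum_tau \sum_(xs : {ffun 'I_n -> 'I_k}) Q tau xs * loss i tau xs.
  have -> : \sum_tau \sum_(xs : {ffun 'I_n -> 'I_k}) Q tau xs * loss i tau xs = 2^-1 *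
      \sum_tau \sum_(xs : {ffun 'I_n -> 'I_k}) (Q tau xs * loss i tau xs +
        Q (flip tau i) xs * loss i (flip tau i) xs).
    under [in RHS]eq_bigr do rewrite big_split/=.
    rewrite [in RHS]big_split/=.
    rewrite -[X in _ = 2^-1 * (_ + X)](reindex_inj (inv_inj (flipK i))
      (P := xpredT) (F := fun tau => \sum_(xs : {ffun 'I_n -> 'I_k}) Q tau xs * loss i tau xs)).
    by field.
  rewrite [leLHS](_ : _ = 2^-1 * \sum_(tau : {ffun 'I_r -> bool}) (s / 2)); last first.
    by rewrite sumr_const -[X in _ = 2^-1 * X]mulr_natr; field.
  rewrite ler_wpM2l ?invr_ge0//; apply: ler_sum => tau _.
  apply: le_trans (_ : \sum_(xs : {ffun 'I_n -> 'I_k})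
    (Num.min (Q tau xs) (Q (flip tau i) xs) * s) <= _).
    rewrite -mulr_suml mulrC ler_wpM2r//.
    by apply: sample_affinity => //; exact: abs_cont.
  apply: ler_sum => xs _.
  apply: le_trans (_ : Num.min (Q tau xs) (Q (flip tau i) xs) *
     (loss i tau xs + loss i (flip tau i) xs) <= _).
    rewrite ler_wpM2l ?le_min ?Q0//.
    apply: le_trans (sep tau i) _; rewrite -big_split/=; apply: ler_sum => x _.
    rewrite -[X in `|X|](subrKA (e xs x)) [leRHS]addrC.
    apply: le_trans (ler_normD _ _) _.
    by rewrite addrC distrC [X in _ + X]distrC lerD// distrC.
  rewrite mulrDr lerD// ler_wpM2r ?sumr_ge0//.
    by rewrite ge_min lexx.
  by rewrite ge_min lexx orbT.
(* The blocks are disjoint. *)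
have total tau xs : \sum_(i < r) loss i tau xs <= \sum_x `|e xs x - p tau x|.
  rewrite /loss (exchange_big_dep predT)//=; apply: ler_sum => x _.
  case: (pickP (fun i : 'I_r => blk x == i)) => [i /eqP bi|no]; last by rewrite big_pred0.
  rewrite (big_pred1 i)// => j /=; rewrite bi; apply/eqP/eqP => [/val_inj//|->//].
apply: le_trans (_ : 2^-1 * \sum_(i < r) \sum_tau
    \sum_(xs : {ffun 'I_n -> 'I_k}) Q tau xs * loss i tau xs <= _).
  apply: le_trans (_ : 2^-1 * \sum_(i < r) (#|{ffun 'I_r -> bool}|%:R * s / 4) <= _).
    rewrite sumr_const card_ord -[X in _ <= _ * X]mulr_natl le_eqVlt; apply/orP; left; apply/eqP.
    by field.
  by rewrite ler_wpM2l ?invr_ge0//; apply: ler_sum => i _; exact: block_risk.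
rewrite exchange_big mulr_sumr; apply: ler_sum => tau _.
rewrite exchange_big mulr_sumr; apply: ler_sum => xs _.
by rewrite -mulr_sumr mulrCA ler_wpM2l ?Q0// /TV ler_wpM2l ?invr_ge0.
Qed.

End assouad.

(** * Laying out consecutive cells *)

Section layout.
Variable l : nat -> nat.

Definition cell_start j : nat := (\sum_(i < j) l i)%N.

(** The index of the cell that contains [x] when consecutive cells of lengths
    [l 0, l 1, ...] are laid out from the origin: the number of cells that end
    at or before [x].  All letters beyond the first [M] cells get the index
    [M]. *)
Definition cell M x : nat := (\sum_(j < M) (cell_start j.+1 <= x))%N.

Lemma cell_startS j : cell_start j.+1 = (cell_start j + l j)%N.
Proof. by rewrite /cell_start big_ord_recr. Qed.

Lemma cell_start_homo i j : (i <= j)%N -> (cell_start i <= cell_start j)%N.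
Proof.
move=> /subnK <-; elim: (j - i)%N => // m IH.
by rewrite addSn cell_startS (leq_trans IH)// leq_addr.
Qed.

Lemma cell_homo M x y : (x <= y)%N -> (cell M x <= cell M y)%N.
Proof.
move=> xy; apply: leq_sum => j _.
by case: (leqP (cell_start j.+1) x) => // /leq_trans/(_ xy) ->.
Qed.

Lemma cell_outside M x : (cell_start M <= x)%N -> cell M x = M.
Proof.
move=> Mx; rewrite /cell (eq_bigr (fun=> 1%N)) ?sum1_card ?card_ord// => j _.
by rewrite (leq_trans _ Mx)// cell_start_homo.
Qed.

Lemma cell_inside M j x : (j < M)%N ->
  (cell_start j <= x < cell_start j.+1)%N -> cell M x = j.
Proof.
move=> jM /andP[jx xj].
rewrite -(subnKC (ltnW jM)) /cell big_split_ord/=.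
rewrite (eq_bigr (fun=> 1%N)) => [|i _]; last first.
  by rewrite (leq_trans _ jx)// cell_start_homo.
rewrite sum1_card card_ord big1 ?addn0// => i _.
by rewrite leqNgt (leq_trans xj)// cell_start_homo// ltnS leq_addr.
Qed.

Lemma sum_over_cells (R : realType) (F : nat -> R) M k :
  (cell_start M <= k)%N -> F M = 0 ->
  \sum_(x < k) F (cell M x) = \sum_(j < M) (l j)%:R * F j.
Proof.
move=> Mk FM.
have upto m : (m <= M)%N -> \sum_(0 <= x < cell_start m) F (cell M x) =
    \sum_(j < m) (l j)%:R * F j.
  elim: m => [|m IH] mM; first by rewrite /cell_start !big_ord0 big_geq.
  rewrite (big_cat_nat (n := cell_start m))//=; last exact: cell_start_homo.
  rewrite IH 1?ltnW// big_ord_recr/=; congr (_ + _).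
  rewrite (eq_big_nat _ _ (F2 := fun=> F m)) => [|x xm]; last by rewrite (cell_inside mM).
  by rewrite sumr_const_nat cell_startS addKn mulr_natl.
rewrite -(big_mkord xpredT (fun x => F (cell M x))).
rewrite (big_cat_nat (n := cell_start M))//= upto//.
rewrite [X in _ + X]big_nat_cond [X in _ + X]big1 ?addr0// => x /andP[/andP[Mx _] _].
by rewrite cell_outside.
Qed.

End layout.

(** Every step of a staircase is made of two cells of the same length, numbered
    [b.*2] and [b.*2.+1]. *)
Lemma sum_over_paired_cells (R : realType) (L : nat -> nat) (F : nat -> R) r k :
  (2 * \sum_(b < r) L b <= k)%N -> F r.*2 = 0 ->
  \sum_(x < k) F (cell (fun c => L c./2) r.*2 x) =
  \sum_(b < r) (L b)%:R * (F b.*2 + F b.*2.+1).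
Proof.
have pairs (V : nmodType) (g : nat -> V) :
    \sum_(c < r.*2) g c = \sum_(b < r) (g b.*2 + g b.*2.+1).
  elim: r => [|r IH]; first by rewrite !big_ord0.
  by rewrite doubleS !big_ord_recr/= IH addrA.
move=> rk Fr; rewrite sum_over_cells//; last first.
  apply: leq_trans rk; rewrite /cell_start.
  have := pairs nat (fun c => L c./2) => /= ->.
  rewrite big_distrr/=; apply: leq_sum => b _.
  by rewrite doubleK uphalf_double mul2n -addnn.
have := pairs R (fun c => (L c./2)%:R * F c) => /= ->; apply: eq_bigr => b _ /=.
by rewrite doubleK uphalf_double mulrDr.
Qed.

Lemma exp1D_le2 (R : realType) n (u : R) : 0 <= u -> n%:R * u <= 2^-1 ->
  (1 + u) ^+ n <= 2.
Proof.
move=> u0 nu.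
apply: le_trans (_ : expR (n%:R * u) <= _).
  rewrite expRM_natl lerXn2r ?nnegrE ?expR_ge0 ?addr_ge0//.
  exact: expR_ge1Dx.
apply: le_trans (_ : expR 2^-1 <= _); first by rewrite ler_expR.
rewrite -[2^-1]opprK expRN -[leRHS]invrK lef_pV2 ?posrE ?expR_gt0//.
by apply: le_trans (expR_ge1Dx _); lra.
Qed.

(** * The hypercube of perturbed staircases *)

Section staircase.
Variables (R : realType) (r : nat) (L : nat -> nat) (h eta : nat -> R) (Z : R).
Hypothesis massE : \sum_(b < r) (L b)%:R * (2 * h b) = Z.
Hypothesis Z0 : 0 < Z.
Hypothesis eta0 : forall b, (b < r)%N -> 0 <= eta b.
Hypothesis h0 : forall b, (b < r)%N -> 0 < h b.
Hypothesis eta_le_h : forall b, (b < r)%N -> 2 * eta b <= h b.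
Hypothesis gap : forall b, (b.+1 < r)%N -> h b.+1 + eta b.+1 <= h b - eta b.
Implicit Types tau : {ffun 'I_r -> bool}.

Definition active tau (b : nat) : bool := if insub b is Some i then tau i else false.

Lemma active_ord tau (i : 'I_r) : active tau i = tau i.
Proof. by rewrite /active valK. Qed.

(** The value of the density on the cell [c].  An active step [b] is raised by
    [eta b] on its left cell and lowered by as much on its right cell, which
    changes neither its mass nor the monotonicity inside the step. *)
Definition step tau (c : nat) : R :=
  if (c./2 < r)%N then
    (h c./2 + (-1) ^+ odd c * (active tau c./2)%:R * eta c./2) / Z
  else 0.

Definition staircase k tau (x : 'I_k) : R :=
  step tau (cell (fun c => L c./2) r.*2 x).

Lemma step_even tau b : (b < r)%N ->
  step tau b.*2 = (h b + (active tau b)%:R * eta b) / Z.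
Proof. by move=> br; rewrite /step doubleK br odd_double mul1r. Qed.

Lemma step_odd tau b : (b < r)%N ->
  step tau b.*2.+1 = (h b - (active tau b)%:R * eta b) / Z.
Proof. by move=> br; rewrite /step /= uphalf_double br odd_double mulN1r mulNr. Qed.

Lemma step_out tau c : (r <= c./2)%N -> step tau c = 0.
Proof. by move=> rc; rewrite /step ltnNge rc. Qed.

Lemma step_ge tau c : (c./2 < r)%N -> h c./2 / (2 * Z) <= step tau c.
Proof.
move=> cr; rewrite /step cr invfM mulrA ler_pM2r ?invr_gt0//.
have := eta_le_h cr; have := eta0 cr; have := h0 cr.
by case: (odd c); case: (active _ _) => /=; lra.
Qed.

Lemma step_gt0 tau c : (c./2 < r)%N -> 0 < step tau c.
Proof.
move=> cr; apply: lt_le_trans (step_ge tau cr).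
by rewrite divr_gt0 ?mulr_gt0// h0.
Qed.

Lemma step_ge0 tau c : 0 <= step tau c.
Proof.
by case: (ltnP c./2 r) => [/(step_gt0 tau)/ltW//|/step_out ->].
Qed.

(** Inside a step the right cell is not higher than the left one; between two
    steps the hypothesis [gap] leaves room for both perturbations. *)
Lemma step_decr tau c : step tau c.+1 <= step tau c.
Proof.
case: (ltnP c.+1./2 r) => [cr|/step_out ->]; last exact: step_ge0.
rewrite -(odd_double_half c) in cr *; set b := c./2 in cr *.
case: (odd c) cr => /=; last first.
  rewrite add0n uphalf_double => br; rewrite step_odd// step_even//.
  rewrite ler_pM2r ?invr_gt0//; have := eta0 br.
  by case: (active _ _) => /=; lra.
rewrite add1n /= doubleK => br; rewrite -doubleS step_even// step_odd 1?ltnW//.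
rewrite ler_pM2r ?invr_gt0//; have := gap br; have := eta0 br; have := eta0 (ltnW br).
by case: (active _ _); case: (active _ _) => /=; lra.
Qed.

Lemma step_nonincreasing tau c c' : (c <= c')%N -> step tau c' <= step tau c.
Proof.
move=> /subnK <-; elim: (c' - c)%N => // m IH.
by rewrite addSn (le_trans (step_decr _ _)).
Qed.

Variable k : nat.
Hypothesis fits : (2 * \sum_(b < r) L b <= k)%N.

Lemma staircase_density tau : is_density (@staircase k tau).
Proof.
split=> [x|]; first exact: step_ge0.
rewrite (sum_over_paired_cells (F := step tau) fits) ?step_out ?doubleK//.
rewrite -[RHS](mulfV (lt0r_neq0 Z0)) -{1}massE mulr_suml; apply: eq_bigr => b _.
by rewrite step_even// step_odd// -mulrA; congr (_ * _); field; exact: lt0r_neq0.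
Qed.

Lemma staircase_monotone tau : monotone_densities R k (@staircase k tau).
Proof.
split; first exact: staircase_density.
move=> x y yx; apply: step_nonincreasing; apply: cell_homo.
by rewrite yx.
Qed.

Lemma active_flip tau (i : 'I_r) (b : 'I_r) :
  active (flip tau i) b = (b == i) (+) active tau b.
Proof. by rewrite !active_ord ffunE. Qed.

(** A flip only changes the two cells of one step, where the density is at least
    half of its unperturbed value [h i / Z]. *)
Lemma staircase_chi2 tau (i : 'I_r) :
  \sum_x staircase (flip tau i) x ^+ 2 / @staircase k tau x <=
  1 + 4 * (L i)%:R * eta i ^+ 2 / (h i * Z).
Proof.
have ZN0 : Z != 0 by exact: lt0r_neq0.
pose diff c := (step (flip tau i) c - step tau c) ^+ 2 / step tau c.
(* Both densities have total mass one, so the first two terms sum to one. *)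
have sqE c : step (flip tau i) c ^+ 2 / step tau c =
    2 * step (flip tau i) c - step tau c + diff c.
  rewrite /diff; case: (ltnP c./2 r) => [cr|rc].
    by field; exact: lt0r_neq0 (step_gt0 tau cr).
  by rewrite !step_out// invr0 !mulr0 addr0 subr0.
rewrite /staircase; under eq_bigr do rewrite sqE.
rewrite big_split/= sumrB -mulr_sumr.
have [_ s1] := staircase_density tau; have [_ s2] := staircase_density (flip tau i).
rewrite /staircase in s1 s2; rewrite s1 s2.
rewrite (_ : 2 * 1 - 1 = 1); last by ring.
rewrite lerD2l (sum_over_paired_cells (F := diff) fits); last first.
  by rewrite /diff !step_out ?doubleK// subrr expr0n mul0r.
rewrite (bigD1 i)//= big1 => [|b bi]; last first.
  rewrite /diff !step_even// !step_odd// active_flip (negPf bi) /=.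
  by rewrite !subrr expr0n/= !mul0r addr0 mulr0.
rewrite addr0.
have half_i : (i.*2.+1./2 < r)%N by rewrite /= uphalf_double.
have half_i' : (i.*2./2 < r)%N by rewrite doubleK.
have le1 := step_ge tau half_i; have le2 := step_ge tau half_i'.
rewrite /= uphalf_double doubleK in le1 le2.
have hZ : 0 < h i / (2 * Z) by rewrite divr_gt0 ?mulr_gt0// h0.
have diffE : (step (flip tau i) i.*2 - step tau i.*2) ^+ 2 = (eta i / Z) ^+ 2 /\
   (step (flip tau i) i.*2.+1 - step tau i.*2.+1) ^+ 2 = (eta i / Z) ^+ 2.
  rewrite !step_even// !step_odd// active_flip eqxx addTb.
  by split; case: (active tau i) => /=; field.
rewrite /diff diffE.1 diffE.2.
apply: le_trans (_ : (L i)%:R * ((eta i / Z) ^+ 2 / (h i / (2 * Z)) +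
   (eta i / Z) ^+ 2 / (h i / (2 * Z))) <= _).
  rewrite ler_wpM2l// lerD// ler_wpM2l ?sqr_ge0// lef_pV2 ?posrE//.
    exact: step_gt0.
  exact: step_gt0.
rewrite le_eqVlt; apply/orP; left; apply/eqP; field.
by rewrite ZN0 lt0r_neq0// h0.
Qed.

Lemma staircase_separation tau (i : 'I_r) :
  2 * (L i)%:R * eta i / Z <=
  \sum_(x | (cell (fun c => L c./2) r.*2 (x : 'I_k))./2 == i)
     `|staircase tau x - staircase (flip tau i) x|.
Proof.
pose F c := if c./2 == i then `|step tau c - step (flip tau i) c| else 0.
rewrite big_mkcond /staircase (sum_over_paired_cells (F := F) fits); last first.
  by rewrite /F doubleK gtn_eqF.
rewrite (bigD1 i)//= ler_wpDr//.
  apply: sumr_ge0 => b _; rewrite mulr_ge0// addr_ge0//.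
    by rewrite /F; case: ifP.
  by rewrite /F; case: ifP.
rewrite /F /= uphalf_double doubleK eqxx !step_even// !step_odd// active_flip eqxx addTb.
have dist_ge (u w : R) : u - w = eta i / Z \/ w - u = eta i / Z ->
    eta i / Z <= `|u - w|.
  by case=> <-; [|rewrite distrC]; exact: ler_norm.
rewrite (_ : 2 * _ * _ / Z = (L i)%:R * (eta i / Z + eta i / Z)); last by ring.
rewrite ler_wpM2l// lerD// dist_ge//; case: (active tau i) => /=;
  by [left; ring | right; ring].
Qed.

(** Assouad's lemma for the staircases.  The requirement that [L b * eta b] is
    the same for all steps gives all coordinates the same separation, and the
    last hypothesis bounds [n] times the chi-square distance between
    neighbours by [1/2]. *)
Lemma minimax_risk_ge_staircase n (v : R) : 0 <= v ->
  (forall b, (b < r)%N -> (L b)%:R * eta b = v) ->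
  (forall b, (b < r)%N -> n%:R * (4 * v * (eta b / h b)) <= Z / 2) ->
  ((r%:R * v / (4 * Z))%:E <= minimax_risk n (monotone_densities R k))%E.
Proof.
move=> v0 Leta small.
rewrite (_ : r%:R * v / (4 * Z) = r%:R * (2 * v / Z) / 8); last first.
  by field; exact: lt0r_neq0.
apply: (@minimax_risk_ge_assouad _ n k r _ (@staircase k)
   (fun x => (cell (fun c => L c./2) r.*2 x)./2)).
- exact: staircase_density.
- exact: staircase_monotone.
- move=> tau i x; rewrite /staircase; set c := cell _ _ _ => c0.
  case: (ltnP c./2 r) => [/(step_gt0 tau)|/step_out ->//].
  by rewrite c0 ltxx.
- move=> tau i; apply: le_trans (_ : (1 + 4 * (L i)%:R * eta i ^+ 2 / (h i * Z)) ^+ n <= _).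
    rewrite lerXn2r ?nnegrE ?staircase_chi2//.
      by apply: sumr_ge0 => x _; rewrite divr_ge0 ?sqr_ge0 ?step_ge0.
    by apply: le_trans (staircase_chi2 tau i); apply: sumr_ge0 => x _;
      rewrite divr_ge0 ?sqr_ge0 ?step_ge0.
  have hi := h0 (ltn_ord i); have ei := eta0 (ltn_ord i).
  have -> : 4 * (L i)%:R * eta i ^+ 2 / (h i * Z) = 4 * v * (eta i / h i) / Z.
    by rewrite -(Leta _ (ltn_ord i)); field; rewrite !lt0r_neq0.
  apply: exp1D_le2.
    by rewrite divr_ge0 ?mulr_ge0 ?invr_ge0// ltW.
  by rewrite mulrA ler_pdivrMr// [leRHS]mulrC small.
- by rewrite divr_ge0 ?mulr_ge0// ltW.
- move=> tau i; apply: le_trans (staircase_separation tau i).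
  by rewrite -(Leta _ (ltn_ord i)) mulrA.
Qed.

End staircase.

(** * Staircases with dyadic widths *)

Section dyadic.
Variables (R : realType) (S N : nat) (theta : R).
Hypothesis S0 : (0 < S)%N.
Hypothesis N0 : (0 < N)%N.
Hypothesis theta0 : 0 <= theta.
Hypothesis theta_le : theta <= 4^-1.

(* Step [b] is the step number [b %% N] among those of width [2 ^ (b %/ N)].
   The heights of these [N] steps drop from [1 / width] to almost half of it,
   where the next width starts. *)
Let width (b : nat) : nat := 2 ^ (b %/ N).
Let height (b : nat) : R := (2 * N%:R - (b %% N)%:R) / (2 * N%:R) / (width b)%:R.
Let amplitude (b : nat) : R := theta / N%:R / (width b)%:R.

Let N0R : 0 < N%:R :> R. Proof. by rewrite ltr0n. Qed.

Let width_gt0 b : 0 < (width b)%:R :> R.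
Proof. by rewrite ltr0n expn_gt0. Qed.

Let modN_lt b : (b %% N)%:R + 1 <= N%:R :> R.
Proof. by rewrite -[1]/(1%:R) -natrD ler_nat addn1 ltn_mod. Qed.

Lemma sum_dyadic_width : (\sum_(b < S * N) width b = N * (2 ^ S - 1))%N.
Proof.
elim: S => [|s IH]; first by rewrite mul0n big_ord0 subnn muln0.
rewrite mulSnr big_split_ord/= IH.
rewrite (eq_bigr (fun=> 2 ^ s)%N) => [|i _]; last first.
  by rewrite /width divnMDl// divn_small ?addn0.
rewrite sum_nat_const card_ord expnS.
have : (0 < 2 ^ s)%N by rewrite expn_gt0.
by nia.
Qed.

Let height_gt0 b : 0 < height b.
Proof.
rewrite !divr_gt0 ?mulr_gt0// subr_gt0; have := modN_lt b; have := N0R; lra.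
Qed.

Let amplitude_ge0 b : 0 <= amplitude b.
Proof. by rewrite !divr_ge0// ltW. Qed.

Let amplitude_le_height b : 2 * amplitude b <= height b.
Proof.
rewrite /amplitude /height mulrA ler_pM2r ?invr_gt0//.
rewrite ler_pdivlMr ?mulr_gt0// -subr_ge0.
rewrite [X in 0 <= X](_ : _ = 2 * N%:R - (b %% N)%:R - 4 * theta);
  last by field; exact: lt0r_neq0.
have := modN_lt b; have := N0R; have : 1 <= N%:R :> R by rewrite ler1n.
by move: theta_le; lra.
Qed.

Let dyadic_gap b : height b.+1 + amplitude b.+1 <= height b - amplitude b.
Proof.
have NN : N%:R != 0 :> R by exact: lt0r_neq0.
have WN : (width b)%:R != 0 :> R by exact: lt0r_neq0.
rewrite -subr_ge0 /height /amplitude modnS.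
case: (boolP (N %| b.+1)%N) => [dv|ndv].
  have -> : (width b.+1)%:R = 2 * (width b)%:R :> R.
    by rewrite /width divnS// dv expnD natrM.
  have -> : (b %% N)%:R = N%:R - 1 :> R.
    apply/eqP; rewrite eq_sym subr_eq -[1]/(1%:R) -natrD eqr_nat addn1.
    have := divn_eq b N; have := divn_eq b.+1 N.
    by rewrite divnS// dv modnS dv mulnDl; move: (b %/ N * N)%N => ?; lia.
  rewrite [X in 0 <= X](_ : _ = (1 - 3 * theta) / (2 * N%:R * (width b)%:R)).
    by rewrite divr_ge0 ?mulr_ge0//; move: theta_le; lra.
  by field; rewrite NN WN.
have -> : (width b.+1) = width b by rewrite /width divnS// (negPf ndv).
rewrite -natr1.
rewrite [X in 0 <= X](_ : _ = (1 - 4 * theta) / (2 * N%:R * (width b)%:R)).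
  by rewrite divr_ge0 ?mulr_ge0//; move: theta_le; lra.
by field; rewrite NN WN.
Qed.

Let Z := \sum_(b < S * N) (width b)%:R * (2 * height b).

Let massE b : (width b)%:R * (2 * height b) = 2 - (b %% N)%:R / N%:R.
Proof. by rewrite /height; field; rewrite !lt0r_neq0. Qed.

Let Z_ge : (S * N)%:R <= Z.
Proof.
rewrite -[X in X%:R]card_ord -sum1_card natr_sum; apply: ler_sum => b _.
rewrite massE -subr_ge0.
rewrite [X in 0 <= X](_ : _ = (N%:R - (b %% N)%:R) / N%:R); last by field; rewrite lt0r_neq0.
by rewrite divr_ge0//; have := modN_lt b; lra.
Qed.

Let Z_le : Z <= 2 * (S * N)%:R.
Proof.
rewrite -[X in _ <= _ * X%:R]card_ord -sum1_card natr_sum mulr_sumr; apply: ler_sum => b _.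
by rewrite massE mulr1 lerBlDr lerDl divr_ge0.
Qed.

(** Here the mass of every step, before normalization, lies between one and two,
    so that the normalization constant [Z] lies between [S * N] and
    [2 * (S * N)]. *)
Lemma minimax_risk_ge_dyadic n k :
  16 * n%:R * theta ^+ 2 <= N%:R ^+ 3 * S%:R -> (2 * (N * (2 ^ S - 1)) <= k)%N ->
  ((theta / (8 * N%:R))%:E <= minimax_risk n (monotone_densities R k))%E.
Proof.
move=> few fits.
have SN0 : 0 < (S * N)%:R :> R by rewrite ltr0n muln_gt0 S0.
have Z0 : 0 < Z by exact: lt_le_trans Z_ge.
apply: (@le_trans _ _ ((S * N)%:R * (theta / N%:R) / (4 * Z))%:E).
  rewrite lee_fin ler_pdivlMr ?mulr_gt0// -subr_ge0.
  rewrite [X in 0 <= X](_ : _ = theta / (2 * N%:R) * (2 * (S * N)%:R - Z)); last first.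
    by field; exact: lt0r_neq0.
  by rewrite mulr_ge0 ?divr_ge0 ?mulr_ge0 ?subr_ge0.
apply: (@minimax_risk_ge_staircase R (S * N) width height amplitude Z) => //.
- by rewrite sum_dyadic_width.
- by rewrite divr_ge0.
- by move=> b _; rewrite /amplitude mulrC divfK// lt0r_neq0.
move=> b _; apply: (@le_trans _ _ (n%:R * (8 * theta ^+ 2 / N%:R ^+ 2))).
  rewrite ler_wpM2l//.
  have -> : amplitude b / height b = 2 * theta / (2 * N%:R - (b %% N)%:R).
    rewrite /amplitude /height; field.
    rewrite !lt0r_neq0// subr_gt0; have := modN_lt b; have := N0R; lra.
  apply: (@le_trans _ _ (4 * (theta / N%:R) * (2 * theta / N%:R))).
    rewrite ler_wpM2l ?mulr_ge0 ?divr_ge0// ler_wpM2l ?mulr_ge0//.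
    have := modN_lt b; have := N0R => ? ?.
    by rewrite lef_pV2 ?posrE//; lra.
  by rewrite le_eqVlt; apply/orP; left; apply/eqP; field; rewrite lt0r_neq0.
apply: (@le_trans _ _ ((S * N)%:R / 2)); last by rewrite ler_pM2r ?Z_ge.
rewrite -subr_ge0 natrM.
rewrite [X in 0 <= X](_ : _ = (N%:R ^+ 3 * S%:R - 16 * n%:R * theta ^+ 2) / (2 * N%:R ^+ 2)).
  by rewrite divr_ge0 ?subr_ge0 ?mulr_ge0 ?exprn_ge0.
by field; rewrite lt0r_neq0.
Qed.

End dyadic.

(** * Cube roots and logarithms *)

Section real_facts.
Variable R : realType.
Implicit Types (x y : R) (m : nat).

Lemma cube_cbrt x : 0 <= x -> (x `^ 3^-1) ^+ 3 = x.
Proof. by move=> x0; rewrite -powR_mulrn ?powR_ge0// -powRrM mulVf// powRr1. Qed.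

Lemma ler_cube x y : 0 <= x -> 0 <= y -> (x ^+ 3 <= y ^+ 3) = (x <= y).
Proof. by move=> x0 y0; rewrite ler_pXn2r ?nnegrE. Qed.

Lemma ln2_gt0 : 0 < ln 2 :> R.
Proof. by rewrite ln_gt0// ltr1n. Qed.

Lemma ln2_le1 : ln 2 <= 1 :> R.
Proof. by rewrite -[2]/(1 + 1) le_ln1Dx//; lra. Qed.

Lemma ler_nat_log2 m x : 0 < x -> (m%:R <= log2 x) = (2 ^+ m <= x).
Proof.
move=> x0; rewrite /log2 ler_pdivlMr ?ln2_gt0// mulr_natl -lnXn//.
by rewrite ler_ln ?posrE ?exprn_gt0.
Qed.

Lemma ltr_log2_nat m x : 0 < x -> (log2 x < m%:R) = (x < 2 ^+ m).
Proof. by move=> x0; rewrite !ltNge ler_nat_log2. Qed.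

End real_facts.

(** * Lower bounds in the three ranges *)

Section lower_bounds.
Variable R : realType.
Variables (n k : nat).
Hypothesis n0 : (0 < n)%N.
Let c : R := n%:R `^ 3^-1.

Let n0R : 0 < n%:R :> R. Proof. by rewrite ltr0n. Qed.
Let c0 : 0 < c. Proof. exact: powR_gt0. Qed.
Let c_ge0 : 0 <= c. Proof. exact: powR_ge0. Qed.
Let c3 : c ^+ 3 = n%:R. Proof. exact: cube_cbrt. Qed.

(** One width and as many steps as fit; the tilt is then limited by the sample
    size, [theta] being a quarter of [sqrt (N ^+ 3 / n)], rather than by
    monotonicity. *)
Lemma minimax_risk_ge_small_alphabet : (2 <= k)%N -> k%:R < 2 * c ->
  ((Num.sqrt (k%:R / n%:R) / 288)%:E <= minimax_risk n (monotone_densities R k))%E.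
Proof.
move=> k2 kc.
pose N := k./2; have k_le : (k <= 3 * N)%N by rewrite /N; lia.
have N_gt0 : (0 < N)%N by rewrite /N; lia.
have N2k : (2 * N <= k)%N by rewrite /N; lia.
have Nc : N%:R <= c.
  rewrite -(ler_pM2l (ltr0Sn R 1)) ltW// (le_lt_trans _ kc)//.
  by rewrite -natrM ler_nat.
have N3n : N%:R ^+ 3 <= n%:R :> R by rewrite -c3 ler_cube.
pose q : R := Num.sqrt (N%:R / n%:R).
have q0 : 0 <= q by exact: sqrtr_ge0.
have q2 : q ^+ 2 = N%:R / n%:R by rewrite sqr_sqrtr ?divr_ge0.
have N0R : 0 < N%:R :> R by rewrite ltr0n.
have theta_sq : (N%:R * q / 4) ^+ 2 = N%:R ^+ 3 / n%:R / 16.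
  by rewrite !exprMn q2; field; exact: lt0r_neq0.
apply: (@le_trans _ _ ((N%:R * q / 4) / (8 * N%:R))%:E).
  rewrite lee_fin (_ : N%:R * q / 4 / (8 * N%:R) = q * 9 / 288); last first.
    by field; exact: lt0r_neq0.
  rewrite ler_pM2r// -ler_sqr ?nnegrE ?mulr_ge0 ?sqrtr_ge0//.
  rewrite exprMn q2 sqr_sqrtr ?divr_ge0// mulrAC ler_pM2r ?invr_gt0//.
  rewrite -natrX -natrM ler_nat; lia.
apply: (@minimax_risk_ge_dyadic R 1 N) => //.
- by rewrite divr_ge0// mulr_ge0// ltW.
- rewrite -ler_sqr ?nnegrE ?divr_ge0 ?mulr_ge0 ?invr_ge0//.
  rewrite theta_sq [leRHS](_ : _ = 1 / 16); last by field.
  by rewrite ler_pM2r ?invr_gt0// ler_pdivrMr// mul1r.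
- by rewrite theta_sq mulr1 le_eqVlt; apply/orP; left; apply/eqP; field; exact: lt0r_neq0.
- by rewrite expn1 muln1.
Qed.

(** The number [S] of widths is about half of [L] rather than all of it: this
    leaves enough letters for the staircase when [L >= 3], while [S = 1] for
    [1 <= L < 3], where [2 * N <= 2 * n^(1/3) <= k].  In both cases
    [L <= 3 * S]. *)
Lemma minimax_risk_ge_large_alphabet : 2 * c <= k%:R -> k%:R < c * 2 ^+ n ->
  (((log2 (k%:R / c) / n%:R) `^ 3^-1 / 288)%:E <=
     minimax_risk n (monotone_densities R k))%E.
Proof.
move=> ck kc; set L := log2 _; set rho := _ `^ _.
have kc0 : 0 < k%:R / c.
  by rewrite divr_gt0//; apply: lt_le_trans ck; rewrite mulr_gt0.
have L1 : 1 <= L by rewrite (@ler_nat_log2 R 1)// expr1 ler_pdivlMr.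
have L_ge0 : 0 <= L by exact: le_trans L1.
have Ln : L < n%:R by rewrite ltr_log2_nat// ltr_pdivrMr// mulrC.
have rho0 : 0 <= rho by exact: powR_ge0.
have rho3 : rho ^+ 3 = L / n%:R by rewrite cube_cbrt// mulr_ge0.
have nat_le_L m : (m%:R <= L) = (2 ^+ m <= k%:R / c) by rewrite ler_nat_log2.
clearbody rho L.
pose S := Num.truncn ((L + 1) / 2).
have /andP[S_le lt_S] : S%:R <= (L + 1) / 2 < S.+1%:R.
  by apply: truncn_itv; lra.
rewrite -(natr1 S) in lt_S.
have S_gt0 : (0 < S)%N by rewrite truncn_gt0; lra.
have S0R : 0 < S%:R :> R by rewrite ltr0n.
have S1R : 1 <= S%:R :> R by rewrite ler1n.
have Sn : S%:R <= n%:R :> R by lra.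
have S_ge : L <= 3 * S%:R by lra.
pose y : R := (n%:R / S%:R) `^ 3^-1.
have y0 : 0 <= y by exact: powR_ge0.
have y3 : y ^+ 3 = n%:R / S%:R by rewrite cube_cbrt// divr_ge0.
have y1 : 1 <= y by rewrite -ler_cube// y3 expr1n ler_pdivlMr// mul1r.
have yc : y <= c.
  by rewrite -ler_cube// y3 c3 ler_pdivrMr// ler_peMr.
pose N := Num.truncn y.
have /andP[N_le lt_N] : N%:R <= y < N.+1%:R by exact: truncn_itv.
rewrite -(natr1 N) in lt_N.
have N_gt0 : (0 < N)%N by rewrite truncn_gt0.
have N0R : 0 < N%:R :> R by rewrite ltr0n.
have N1R : 1 <= N%:R :> R by rewrite ler1n.
clearbody N y S.
have y_le2N : y <= 2 * N%:R by lra.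
apply: (@le_trans _ _ (12^-1 / (8 * N%:R))%:E).
  rewrite lee_fin (_ : 12^-1 / (8 * N%:R) = 3 / N%:R / 288); last first.
    by field; exact: lt0r_neq0.
  rewrite ler_pM2r// ler_pdivlMr//.
  rewrite -ler_cube ?mulr_ge0// exprMn rho3.
  apply: (@le_trans _ _ (L / n%:R * (n%:R / S%:R))).
    by rewrite ler_wpM2l ?divr_ge0// -y3 ler_cube.
  rewrite (_ : L / n%:R * (n%:R / S%:R) = L / S%:R); last first.
    by field; rewrite !lt0r_neq0.
  by rewrite ler_pdivrMr// (le_trans S_ge)// ler_pM2r//; lra.
apply: (@minimax_risk_ge_dyadic R S N) => //.
- by lra.
- have : n%:R / S%:R <= (2 * N%:R) ^+ 3 :> R by rewrite -y3 ler_cube// mulr_ge0.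
  rewrite ler_pdivrMr// exprMn => nN.
  have n_ge0 : 0 <= n%:R :> R by [].
  rewrite (_ : 2 ^+ 3 = 8) -?(mulrA 8) in nN; last by ring.
  rewrite [leLHS](_ : _ = n%:R / 9); last by field.
  by move: nN; move: (N%:R ^+ 3 * S%:R) => t nN; lra.
have [S1|S2] := leqP S 1.
  have -> : S = 1%N by apply/eqP; rewrite eqn_leq S1.
  rewrite expn1 muln1 -(ler_nat R) natrM (le_trans _ ck)// ler_pM2l//.
  exact: le_trans yc.
have L3 : 3 <= L.
  have : 2%:R <= S%:R :> R by rewrite ler_nat.
  by lra.
apply: (@leq_trans (N * 2 ^ S.+1)); first by rewrite expnS mulnCA !leq_mul2l leq_subr !orbT.
rewrite -(ler_nat R) natrM natrX -ler_pdivlMl//.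
apply: (@le_trans _ _ (k%:R / c)).
  by rewrite -nat_le_L -(natr1 S); lra.
rewrite mulrC ler_pM2r; last by apply: lt_le_trans ck; rewrite mulr_gt0.
by rewrite lef_pV2 ?posrE// (le_trans N_le).
Qed.

(** Widths up to [2 ^ n.-1], each used once.  The [2 * (2 ^ n - 1)] letters are
    available because [n^(1/3) >= 2]. *)
Lemma minimax_risk_ge_huge_alphabet : (8 <= n)%N -> c * 2 ^+ n <= k%:R ->
  ((32^-1)%:E <= minimax_risk n (monotone_densities R k))%E.
Proof.
move=> n8 ck.
have c2 : 2 <= c.
  by rewrite -ler_cube// c3 -natrX ler_nat.
have -> : 32^-1 = 4^-1 / (8 * 1%:R) :> R by field.
apply: (@minimax_risk_ge_dyadic R n 1) => //.
  by rewrite expr1n mul1r le_eqVlt; apply/orP; left; apply/eqP; field.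
apply: (@leq_trans (2 * 2 ^ n)); first by rewrite mul1n; lia.
rewrite -(ler_nat R) natrM natrX (le_trans _ ck)// ler_pM2r//.
Qed.

End lower_bounds.

(** * Bins of geometrically growing length *)

Section log_bins.
Variables (R : realType) (A : nat) (eps : R).
Hypothesis A0 : (0 < A)%N.
Hypothesis eps0 : 0 < eps.
Hypothesis eps1 : eps <= 1.

Let A0R : 0 < A%:R :> R. Proof. by rewrite ltr0n. Qed.

Let eps_ge0 : 0 <= eps. Proof. exact: ltW. Qed.

Definition log_position (x : nat) : R := 2 * ln (x.+1%:R / A%:R) / eps.

(** Singletons up to the letter [A], then bins whose end points grow
    geometrically by a factor [expR (eps / 2)]. *)
Definition log_bin (x : nat) : nat :=
  if (x < A)%N then x else (A + Num.truncn (log_position x))%N.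

Lemma log_position_homo x y : (x <= y)%N -> log_position x <= log_position y.
Proof.
move=> xy; rewrite ler_pM2r ?invr_gt0// ler_pM2l// ler_ln ?posrE ?divr_gt0//.
by rewrite ler_pM2r ?invr_gt0// ler_nat.
Qed.

Lemma log_position_ge0 x : (A <= x)%N -> 0 <= log_position x.
Proof.
move=> Ax; rewrite divr_ge0 ?mulr_ge0 ?ln_ge0//.
by rewrite ler_pdivlMr// mul1r ler_nat ltnW.
Qed.

Lemma log_bin_homo x y : (x <= y)%N -> (log_bin x <= log_bin y)%N.
Proof.
move=> xy; rewrite /log_bin; case: (ltnP y A) => [yA|Ay].
  by rewrite (leq_ltn_trans xy yA).
case: (ltnP x A) => [xA|Ax]; first by rewrite (leq_trans (ltnW xA))// leq_addr.
by rewrite leq_add2l le_truncn// log_position_homo.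
Qed.

(** Two letters of a geometric bin have a ratio below [expR (eps / 2)], which is
    at most [(1 - eps / 2)^-1 <= 1 + eps]. *)
Lemma log_bin_narrow x y : (x <= y)%N -> log_bin x = log_bin y ->
  (y - x)%N%:R <= eps * x.+1%:R.
Proof.
move=> xy; rewrite /log_bin.
have trivial_case : x = y -> (y - x)%N%:R <= eps * x.+1%:R.
  by move=> ->; rewrite subnn mulr_ge0// ltW.
case: (ltnP y A) => [yA|Ay]; first by rewrite (leq_ltn_trans xy yA).
case: (ltnP x A) => [xA xE|Ax /addnI same].
  by move: xA; rewrite xE ltnNge leq_addr.
have /andP[lx _] := truncn_itv (log_position_ge0 Ax).
have /andP[_ uy] := truncn_itv (log_position_ge0 Ay).
rewrite -same -natr1 in uy.
have x1 : 0 < x.+1%:R :> R by rewrite ltr0n.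
have y1 : 0 < y.+1%:R :> R by rewrite ltr0n.
have ln_close : ln (y.+1%:R / x.+1%:R) < eps / 2.
  have : log_position y - log_position x < 1 by lra.
  rewrite /log_position -mulrBl -mulrBr -ln_div ?posrE ?divr_gt0//.
  rewrite ltr_pdivrMr// mul1r.
  rewrite (_ : y.+1%:R / A%:R / (x.+1%:R / A%:R) = y.+1%:R / x.+1%:R); first by lra.
  by field; rewrite !lt0r_neq0.
have ratio : y.+1%:R <= x.+1%:R * (1 + eps).
  rewrite mulrC -ler_pdivrMr//.
  have q0 : 0 < y.+1%:R / x.+1%:R :> R by rewrite divr_gt0.
  rewrite -[leLHS]lnK ?posrE// (le_trans (ltW (y := expR (eps / 2)) _))//.
    by rewrite ltr_expR.
  have eps1_gt0 : 0 < 1 + eps by rewrite addr_gt0.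
  rewrite -[eps / 2]opprK expRN -[leRHS]invrK lef_pV2 ?posrE ?expR_gt0 ?invr_gt0//.
  apply: le_trans (expR_ge1Dx _).
  rewrite -div1r ler_pdivrMr//.
  rewrite -subr_ge0 [X in 0 <= X](_ : _ = eps * (1 - eps) / 2); last by field.
  by rewrite divr_ge0// mulr_ge0 ?subr_ge0// ltW.
rewrite natrB//; rewrite -(natr1 x) -(natr1 y) in ratio *; lra.
Qed.

Lemma minimax_risk_le_log_bins n k (t : R) : (0 < n)%N -> (A <= k)%N -> 0 < t ->
  (minimax_risk n (monotone_densities R k) <=
     (eps + t / (4 * n%:R) +
      (A%:R + 2 * ln (k%:R / A%:R) / eps + 1) / (4 * t))%:E)%E.
Proof.
move=> n0 Ak t0; have k0 : (0 < k)%N by exact: leq_trans Ak.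
pose M := (A + Num.truncn (log_position k.-1))%N.
have binM (x : 'I_k) : (log_bin x <= M)%N.
  have xk : (x <= k.-1)%N by have := ltn_ord x; lia.
  rewrite /log_bin; case: (ltnP x A) => [xA|Ax].
    by rewrite (leq_trans (ltnW xA))// leq_addr.
  by rewrite leq_add2l le_truncn// log_position_homo.
pose b (x : 'I_k) : 'I_M.+1 := inord (log_bin x).
have bE x y : b x = b y -> log_bin x = log_bin y.
  by move=> /(congr1 (@nat_of_ord _)); rewrite /b !inordK ?ltnS.
apply: (@le_trans _ _ (eps + t / (4 * n%:R) + #|'I_M.+1|%:R / (4 * t))%:E).
  apply: (minimax_risk_le_histogram (b := b)) => //.
    move=> x z y /andP[xz zy] /bE bxy; congr inord; apply/eqP.
    by rewrite eqn_leq log_bin_homo// -bxy log_bin_homo.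
  by move=> x y xy /bE; exact: log_bin_narrow.
rewrite lee_fin lerD2l ler_pM2r ?invr_gt0 ?mulr_gt0// card_ord -natr1 lerD2r.
rewrite /M natrD lerD2l (_ : 2 * _ / eps = log_position k.-1); last by rewrite /log_position prednK.
rewrite truncn_le.
rewrite divr_ge0 ?mulr_ge0 ?ln_ge0//.
by rewrite ler_pdivlMr// mul1r ler_nat prednK.
Qed.

End log_bins.

(** * Upper bounds *)

Section upper_bounds.
Variable R : realType.
Variables (n k : nat).
Hypothesis n0 : (0 < n)%N.
Let c : R := n%:R `^ 3^-1.

Let n0R : 0 < n%:R :> R. Proof. by rewrite ltr0n. Qed.
Let c0 : 0 < c. Proof. exact: powR_gt0. Qed.
Let c_ge0 : 0 <= c. Proof. exact: powR_ge0. Qed.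
Let c3 : c ^+ 3 = n%:R. Proof. exact: cube_cbrt. Qed.

Lemma minimax_risk_le_small_alphabet : (0 < k)%N ->
  (minimax_risk n (monotone_densities R k) <= (Num.sqrt (k%:R / n%:R))%:E)%E.
Proof.
move=> k0; pose q : R := Num.sqrt (k%:R / n%:R).
have k0R : 0 < k%:R :> R by rewrite ltr0n.
have q0 : 0 < q by rewrite sqrtr_gt0 divr_gt0.
have q2 : q ^+ 2 = k%:R / n%:R by rewrite sqr_sqrtr ?divr_ge0.
have kE : k%:R = q ^+ 2 * n%:R by rewrite q2 divfK// lt0r_neq0.
apply: (@le_trans _ _ (0 + n%:R * q / (4 * n%:R) + #|'I_k|%:R / (4 * (n%:R * q)))%:E).
  apply: (minimax_risk_le_histogram (b := id)) => //; last by rewrite mulr_gt0.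
    by move=> x z y /andP[xz zy] xy; apply/val_inj/eqP; rewrite eqn_leq zy /= -xy.
  by move=> x y _ ->; rewrite subnn mul0r.
rewrite lee_fin card_ord -/q [leLHS](_ : _ = q / 2); first by lra.
by rewrite kE; field; rewrite !lt0r_neq0.
Qed.

(** With [A] about [n^(1/3)] singletons and [eps = (L / n)^(1/3)] there are at
    most [6 * L / eps = 6 * n * eps ^+ 2] bins, and [t = 2 * n * eps] makes all
    the error terms proportional to [eps]. *)
Lemma minimax_risk_le_large_alphabet : 2 * c <= k%:R -> k%:R < c * 2 ^+ n ->
  (minimax_risk n (monotone_densities R k) <=
   (3 * (log2 (k%:R / c) / n%:R) `^ 3^-1)%:E)%E.
Proof.
move=> ck kc; set L := log2 _; set eps := _ `^ _.
have k0R : 0 < k%:R :> R by apply: lt_le_trans ck; rewrite mulr_gt0.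
have kc0 : 0 < k%:R / c by rewrite divr_gt0.
have L1 : 1 <= L by rewrite (@ler_nat_log2 R 1)// expr1 ler_pdivlMr.
have L_ge0 : 0 <= L by exact: le_trans L1.
have Ln : L < n%:R by rewrite ltr_log2_nat// ltr_pdivrMr// mulrC.
have lnL : ln (k%:R / c) <= L.
  rewrite /L /log2 ler_pdivlMr ?ln2_gt0// ler_piMr ?ln2_le1//.
  by rewrite ln_ge0// ler_pdivlMr// mul1r (le_trans _ ck)// ler_peMl// ler1n.
have eps_ge0 : 0 <= eps by exact: powR_ge0.
have eps3 : eps ^+ 3 = L / n%:R by rewrite cube_cbrt// mulr_ge0.
clearbody eps L.
have eps0 : 0 < eps.
  rewrite lt_neqAle eps_ge0 andbT; apply/eqP => e0.
  by move: eps3; rewrite -e0 expr0n /= => /esym; apply/eqP; rewrite lt0r_neq0// divr_gt0//; lra.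
have eps1 : eps <= 1.
  by rewrite -ler_cube// eps3 expr1n ler_pdivrMr// mul1r ltW.
have LE : L = n%:R * eps ^+ 3 by rewrite eps3; field; exact: lt0r_neq0.
have c1 : 1 <= c by rewrite -ler_cube// c3 expr1n ler1n.
pose A := Num.truncn c.
have /andP[A_le lt_A] : A%:R <= c < A.+1%:R by exact: truncn_itv.
rewrite -(natr1 A) in lt_A.
have A_gt0 : (0 < A)%N by rewrite truncn_gt0.
have A0R : 0 < A%:R :> R by rewrite ltr0n.
have A1R : 1 <= A%:R :> R by rewrite ler1n.
clearbody A.
have Ak : (A <= k)%N by rewrite -(ler_nat R) (le_trans A_le)// (le_trans _ ck)// ler_peMl// ler1n.
have t0 : 0 < 2 * n%:R * eps by rewrite !mulr_gt0.
apply: le_trans (minimax_risk_le_log_bins A_gt0 eps0 eps1 n0 Ak t0) _.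
have ln_kA : ln (k%:R / A%:R) <= 2 * L.
  apply: (@le_trans _ _ (ln (2 * (k%:R / c)))).
    rewrite ler_ln ?posrE ?mulr_gt0 ?invr_gt0//.
    rewrite mulrCA ler_pM2l// -ler_pdivrMl// -invfM lef_pV2 ?posrE ?mulr_gt0//; lra.
  by rewrite lnM ?posrE//; have := ln2_le1 R; lra.
have c_eps : c * eps <= L.
  rewrite -ler_cube ?mulr_ge0// exprMn c3 eps3 mulrC divfK ?lt0r_neq0//.
  by rewrite exprS ler_peMr// exprn_ege1.
have bins : A%:R + 2 * ln (k%:R / A%:R) / eps + 1 <= 6 * n%:R * eps ^+ 2.
  rewrite -(ler_pM2r eps0) mulrDl mulrDl mul1r divfK ?lt0r_neq0//.
  rewrite (_ : 6 * n%:R * eps ^+ 2 * eps = 6 * L); last by rewrite LE; ring.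
  have : A%:R * eps <= c * eps by rewrite ler_pM2r.
  by lra.
rewrite lee_fin; apply: (@le_trans _ _ (eps + 2 * n%:R * eps / (4 * n%:R) +
    6 * n%:R * eps ^+ 2 / (4 * (2 * n%:R * eps)))).
  by rewrite lerD2l ler_pM2r// invr_gt0 mulr_gt0.
rewrite [leLHS](_ : _ = 9 / 4 * eps); last by field; rewrite !lt0r_neq0.
by rewrite ler_pM2r//; lra.
Qed.

End upper_bounds.

(** * The minimax rate *)

Lemma minimax_risk_rate_bounds (R : realType) n k :
  (8 <= n)%N -> (2 <= k)%N ->
  [/\ 0 < rate R n k,
      ((rate R n k / 288)%:E <= minimax_risk n (monotone_densities R k))%E &
      (minimax_risk n (monotone_densities R k) <= (3 * rate R n k)%:E)%E].
Proof.
move=> n8 k2; rewrite /rate.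
have n0 : (0 < n)%N by exact: leq_trans n8.
have k0 : (0 < k)%N by exact: leq_trans k2.
have k0R : 0 < k%:R :> R by rewrite ltr0n.
have n0R : 0 < n%:R :> R by rewrite ltr0n.
have c0 : 0 < n%:R `^ 3^-1 :> R by exact: powR_gt0.
case: (ltP k%:R (2 * n%:R `^ 3^-1)) => [small|large].
  split; first by rewrite sqrtr_gt0 divr_gt0.
    exact: minimax_risk_ge_small_alphabet.
  apply: le_trans (minimax_risk_le_small_alphabet _ n0 k0) _.
  by rewrite lee_fin ler_peMl ?sqrtr_ge0//; lra.
case: (ltP k%:R (n%:R `^ 3^-1 * 2 ^+ n)) => [moderate|huge].
  split; last exact: minimax_risk_le_large_alphabet.
    rewrite powR_gt0// divr_gt0//.
    apply: (@lt_le_trans _ _ 1%:R) => //; rewrite ler_nat_log2 ?divr_gt0//.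
    by rewrite expr1 ler_pdivlMr.
  exact: minimax_risk_ge_large_alphabet.
split => //.
  apply: le_trans (minimax_risk_ge_huge_alphabet n0 n8 huge).
  by rewrite lee_fin; lra.
by apply: le_trans (minimax_risk_le_half _ _ _) _; rewrite lee_fin; lra.
Qed.

Theorem theorem2p1 (R : realType) :
  exists C : R, 1 <= C /\
  exists n0 : nat, forall n k : nat,
    (1 <= n)%N -> (n0 <= n)%N -> (2 <= k)%N ->
    ((C^-1)%:E <= minimax_risk n (monotone_densities R k) / (rate R n k)%:E)%E /\
    (minimax_risk n (monotone_densities R k) / (rate R n k)%:E <= C%:E)%E.
Proof.
exists 288; split; first by lra.
exists 8%N => n k n1 n8 k2.
have [rate0 lower upper] := @minimax_risk_rate_bounds R n k n8 k2.
rewrite inver gt_eqF//; split.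
  by rewrite lee_pdivlMr// -EFinM mulrC.
rewrite lee_pdivrMr// (le_trans upper)// -EFinM lee_fin ler_pM2r//; lra.
Qed.
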